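(* Let $(B,+,\circ)$ be a Dedekind skew brace such that $(B,+)$ is not periodic. Let $X$ be a subset of $B$ such that $B=\langle X\rangle$. If $x\ast x=0$ for all $x\in X$, then $B$ is a trivial brace.
   Context: A skew brace is a triple $(B,+,\circ)$ with $(B,+)$, $(B,\circ)$ (not necessarily abelian) groups such that $a\circ(b+c)=a\circ b-a+a\circ c$ for all $a,b,c\in B$. The identities of the two groups coincide and are denoted by $0$. For $a,b\in B$ put $\lambda_a(b)=-a+a\circ b$ and $a\ast b=-a+a\circ b-b$. A sub-skew brace is a subset that is a subgroup of both $(B,+)$ and $(B,\circ)$; $\langle X\rangle$ is the smallest sub-skew brace containing $X$. An ideal is a subgroup of $(B,+)$ that is normal in $(B,+)$, invariant under all $\lambda_b$ ($b\in B$), and normal in $(B,\circ)$. $B$ is Dedekind if all its sub-skew braces are ideals of $B$. $B$ is trivial (a trivial brace) if $a+b=a\circ b$ for all $a,b\in B$. A group is periodic if all its elements have finite order. *)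

(* Defs.v *)
From HB Require Import structures.
From mathcomp Require Import all_boot all_algebra.
From mathcomp Require Import classical_sets.

Set Implicit Arguments.
Unset Strict Implicit.
Unset Printing Implicit Defensive.

Import GRing.Theory.
Local Open Scope classical_set_scope.
Local Open Scope ring_scope.

Reserved Notation "a \circ b" (at level 40, left associativity).
Notation "a \circ b" := (a%R * b%R)%g : ring_scope.

(* [baseZmodType] and [baseGroupType] only supply the symbols +, 0, - and
   *, 1, ^-1 (with natural powers), without any law; the group laws of both
   operations are in this mixin.  ([zmodType] would force + to be commutative.)
   That 0 = 1 follows from sb_circDr with a := 1. *)
HB.mixin Record isSkewBrace B of GRing.BaseZmodule B & BaseGroup B := {
  sb_addA : forall a b c : B, a + (b + c) = a + b + c;
  sb_add0r : forall a : B, 0 + a = a;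
  sb_addNr : forall a : B, - a + a = 0;
  sb_circA : forall a b c : B, a \circ (b \circ c) = a \circ b \circ c;
  sb_circ1g : forall a : B, 1%g \circ a = a;
  sb_circVg : forall a : B, a^-1%g \circ a = 1%g;
  sb_circDr : forall a b c : B, a \circ (b + c) = a \circ b - a + a \circ c
}.

#[short(type="skewBraceType")]
HB.structure Definition SkewBrace :=
  {B of isSkewBrace B & GRing.BaseZmodule B & BaseGroup B}.

Section Theory.
Variable B : skewBraceType.
Implicit Types (a b : B) (A X : set B).

Definition sb_lambda a b : B := - a + a \circ b.

Definition sb_star a b : B := - a + a \circ b - b.

Definition add_subgroup A : Prop :=
  [/\ A 0, forall a b, A a -> A b -> A (a + b) & forall a, A a -> A (- a)].

Definition circ_subgroup A : Prop :=
  [/\ A 1%g, forall a b, A a -> A b -> A (a \circ b)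
    & forall a, A a -> A a^-1%g].

Definition add_normal A : Prop :=
  add_subgroup A /\ forall a b, A a -> A (b + a - b).

Definition circ_normal A : Prop :=
  circ_subgroup A /\ forall a b, A a -> A (b \circ a \circ b^-1%g).

Definition sub_skew_brace A : Prop := add_subgroup A /\ circ_subgroup A.

Definition generated X : set B := smallest sub_skew_brace X.

Definition ideal A : Prop :=
  [/\ add_normal A, forall b a, A a -> A (sb_lambda b a) & circ_normal A].

End Theory.

Definition dedekind (B : skewBraceType) : Prop :=
  forall A : set B, sub_skew_brace A -> ideal A.

Definition trivial_brace (B : skewBraceType) : Prop :=
  forall a b : B, a + b = a \circ b.

Definition add_periodic (B : skewBraceType) : Prop :=
  forall a : B, exists n : nat, (0 < n)%N /\ a *+ n = 0.

(* Main.v *)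
Require Import Defs.
From mathcomp Require Import all_boot all_algebra.
From mathcomp Require Import boolp classical_sets.
Local Open Scope classical_set_scope.
Local Open Scope ring_scope.

Set Implicit Arguments.
Unset Strict Implicit.
Unset Printing Implicit Defensive.

(** Call [x] self-fixed if [x * x = 0], that is, if [lambda x] fixes [x].  Then
the additive cyclic group [Zx] is a sub-skew brace, hence an ideal of the
Dedekind skew brace [B], so that [x * y] lies in [Zx] as well as in [Zy] for any
two self-fixed [x] and [y].  The heart of the matter is that this forces
[x * y = 0] ([lambda_self_fixed]).

- If [y] has infinite additive order, put [a := x * y], so that
  [lambda x y = a + y].  As [a] is in [Zx], [lambda x] fixes [a]; but [a] is
  also a multiple [n y] (up to sign), and so [n y = n (a + y) = n a + n y].  Thus
  [n a = 0], that is, [n ^ 2 y = 0], hence [n = 0] and [a = 0].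
- If [y] has finite order and [x] does not, then [Zx] and [Zy] meet trivially.
- If both have finite order, a self-fixed [z] of infinite order is needed.  By
  the previous cases [lambda z] fixes [x] and [y], and [lambda x] fixes [z].
  Hence [z + x = z o x] is again self-fixed, and it has infinite order, so that
  [lambda (z + x) = lambda z lambda x] fixes [y].  As [lambda z] is the identity
  on [Zy], which contains [lambda x y], it follows that [lambda x y = y].

Such a [z] exists in [X].  The additive group is generated by [X]
([add_generated_full]), because the cyclic ideals make the additive subgroup
generated by [X] invariant under [lambda].  If all elements of [X] had finite
order, [B] would be generated by finite normal subgroups and would be periodic.

At the end, each [lambda x] with [x] in [X] fixes the additive generators, so it
is the identity, and the kernel of [lambda] is an additive subgroup that contains
[X]; hence [lambda] is trivial, and so is [B]. *)

(** * The two group structures *)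

Section LeftAxioms.
Variables (T : Type) (op : T -> T -> T) (e : T) (inv : T -> T).
Hypotheses (opA : associative op) (op1 : left_id e op)
  (opV : left_inverse e inv op).

Lemma right_inverse_of_left : right_inverse e inv op.
Proof.
by move=> x; rewrite -[LHS]op1 -{1}(opV (inv x)) -opA (opA (inv x)) opV op1 opV.
Qed.

Lemma right_id_of_left : right_id e op.
Proof. by move=> x; rewrite -(opV x) opA right_inverse_of_left op1. Qed.

End LeftAxioms.

Section SkewBraceTheory.
Variable B : skewBraceType.
Implicit Types (a b c x y z : B) (A X : set B).

Lemma sb_addrN a : a - a = 0.
Proof. exact: (right_inverse_of_left (@sb_addA B) (@sb_add0r B) (@sb_addNr B)). Qed.

Lemma sb_addr0 a : a + 0 = a.
Proof. exact: (right_id_of_left (@sb_addA B) (@sb_add0r B) (@sb_addNr B)). Qed.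

Lemma sb_addKr a b : - a + (a + b) = b.
Proof. by rewrite sb_addA sb_addNr sb_add0r. Qed.

Lemma sb_addNKr a b : a + (- a + b) = b.
Proof. by rewrite sb_addA sb_addrN sb_add0r. Qed.

Lemma sb_addrK a b : b + a - a = b.
Proof. by rewrite -sb_addA sb_addrN sb_addr0. Qed.

Lemma sb_subrK a b : b - a + a = b.
Proof. by rewrite -sb_addA sb_addNr sb_addr0. Qed.

Lemma sb_addrI a b c : a + b = a + c -> b = c.
Proof. by move=> /(congr1 (+%R (- a))); rewrite !sb_addKr. Qed.

Lemma sb_addIr a b c : b + a = c + a -> b = c.
Proof. by move=> /(congr1 (fun d => d - a)); rewrite !sb_addrK. Qed.

Lemma sb_opprK a : - - a = a.
Proof. by apply: (@sb_addrI (- a)); rewrite sb_addrN sb_addNr. Qed.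

Lemma sb_oppr0 : - 0 = 0 :> B.
Proof. by rewrite -[LHS]sb_add0r sb_addrN. Qed.

Lemma sb_opprD a b : - (a + b) = - b - a.
Proof.
by apply: (@sb_addrI (a + b)); rewrite sb_addrN -sb_addA sb_addNKr sb_addrN.
Qed.

Lemma sb_subr_eq0 a b : a - b = 0 -> a = b.
Proof. by move=> ab0; rewrite -(sb_subrK b a) ab0 sb_add0r. Qed.

Lemma sb_circgV a : a \circ a^-1%g = 1%g.
Proof.
exact: (right_inverse_of_left (@sb_circA B) (@sb_circ1g B) (@sb_circVg B)).
Qed.

Lemma sb_circg1 a : a \circ 1%g = a.
Proof.
exact: (right_id_of_left (@sb_circA B) (@sb_circ1g B) (@sb_circVg B)).
Qed.

Lemma sb_circKg a b : a^-1%g \circ (a \circ b) = b.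
Proof. by rewrite sb_circA sb_circVg sb_circ1g. Qed.

Lemma sb_circVKg a b : a \circ (a^-1%g \circ b) = b.
Proof. by rewrite sb_circA sb_circgV sb_circ1g. Qed.

Lemma sb_invgK a : (a^-1)^-1%g = a.
Proof. by rewrite -[LHS]sb_circg1 -(sb_circVg a) sb_circKg. Qed.

Lemma sb_invg_unique a b : a \circ b = 1%g -> a^-1%g = b.
Proof. by move=> ab1; rewrite -(sb_circKg a b) ab1 sb_circg1. Qed.

Lemma sb_one0 : 1%g = 0 :> B.
Proof.
have := sb_circDr (1%g : B) 0 0.
rewrite !sb_circ1g !sb_add0r sb_addr0 => /(congr1 (@GRing.opp B)).
by rewrite sb_opprK sb_oppr0.
Qed.

(** * The lambda maps *)

Local Notation lam := sb_lambda.

Lemma circE a b : a \circ b = a + lam a b.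
Proof. by rewrite sb_addNKr. Qed.

Lemma lambdaD a b c : lam a (b + c) = lam a b + lam a c.
Proof. by rewrite /lam sb_circDr !sb_addA. Qed.

Lemma lambda0 a : lam a 0 = 0.
Proof. by rewrite /lam -sb_one0 sb_circg1 sb_addNr sb_one0. Qed.

Lemma lambda0l b : lam 0 b = b.
Proof. by rewrite /lam sb_oppr0 sb_add0r -sb_one0 sb_circ1g. Qed.

Lemma lambdaN a b : lam a (- b) = - lam a b.
Proof.
by apply: (@sb_addrI (lam a b)); rewrite -lambdaD !sb_addrN lambda0.
Qed.

Lemma lambdaM a b c : lam (a \circ b) c = lam a (lam b c).
Proof.
by apply: (@sb_addrI (a \circ b)); rewrite -circE -sb_circA !circE lambdaD sb_addA.
Qed.

Lemma fixed_add_subgroup a : add_subgroup [set b | lam a b = b].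
Proof.
split=> [|b c /= fb fc|b /= fb]; first exact: lambda0.
- by rewrite lambdaD fb fc.
- by rewrite lambdaN fb.
Qed.

(** The elements whose [lam] is the identity on [A] form a group for [\circ].
Those of them that lie in [A] fix one another, so their sums are [\circ]-products
and their opposites are [\circ]-inverses.  The case [A := setT] is the kernel of
[lam]; for [A] cyclic this gives the sub-skew brace [Zx]. *)
Lemma kernel_add_subgroup A : add_subgroup A ->
  add_subgroup [set a | A a /\ forall b, A b -> lam a b = b].
Proof.
move=> [A0 AD AN]; split=> [|a b [Aa fa] [Ab fb]|a [Aa fa]].
- by split=> // b _; exact: lambda0l.
- split=> [|c Ac]; first exact: AD.
  by rewrite -(fa b Ab) -circE lambdaM fb // fa.
- split=> [|c Ac]; first exact: AN.
  (* [- a] is the inverse of [a] for both operations *)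
  have aN : a \circ (- a) = 1%g.
    by rewrite circE (fa _ (AN _ Aa)) sb_addrN sb_one0.
  rewrite -(sb_invg_unique aN) -[in LHS](fa c Ac) -lambdaM sb_circVg sb_one0.
  exact: lambda0l.
Qed.

(** * Multiples and finite order *)

Lemma sb_mulrS a n : a *+ n.+1 = a + a *+ n.
Proof. by case: n => // ; rewrite sb_addr0. Qed.

Lemma sb_mulrnDr a m n : a *+ (m + n) = a *+ m + a *+ n.
Proof.
elim: m => [|m IHm]; first by rewrite sb_add0r.
by rewrite addSn !sb_mulrS IHm sb_addA.
Qed.

Lemma sb_mulrnA a m n : a *+ (m * n) = a *+ m *+ n.
Proof.
by elim: n => [|n IHn]; rewrite ?muln0 // mulnS sb_mulrnDr IHn -sb_mulrS.
Qed.

Lemma sb_mul0rn n : 0 *+ n = 0 :> B.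
Proof. by elim: n => // n IHn; rewrite sb_mulrS IHn sb_add0r. Qed.

Lemma sb_mulNrn a n : (- a) *+ n = - (a *+ n).
Proof.
elim: n => [|n IHn]; first by rewrite sb_oppr0.
by rewrite (sb_mulrS (- a)) IHn -sb_opprD -addn1 sb_mulrnDr.
Qed.

Lemma sb_mulrnDl a b n : a + b = b + a -> (a + b) *+ n = a *+ n + b *+ n.
Proof.
move=> ab; have abn m : b + a *+ m = a *+ m + b.
  elim: m => [|m IHm]; first by rewrite sb_addr0 sb_add0r.
  by rewrite sb_mulrS sb_addA -ab -!sb_addA IHm.
elim: n => [|n IHn]; first by rewrite sb_addr0.
by rewrite !sb_mulrS IHn -!sb_addA; congr (a + _); rewrite !sb_addA abn.
Qed.

Lemma lambdaMn a b n : lam a (b *+ n) = lam a b *+ n.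
Proof.
by elim: n => [|n IHn]; [exact: lambda0 | rewrite !sb_mulrS lambdaD IHn].
Qed.

Definition torsion a := exists n, (0 < n)%N /\ a *+ n = 0.

Lemma torsion0 : torsion 0.
Proof. by exists 1%N. Qed.

Lemma torsionN a : torsion a -> torsion (- a).
Proof. by case=> n [n0 an]; exists n; rewrite sb_mulNrn an sb_oppr0. Qed.

Lemma torsion_mulrn a n : torsion a -> torsion (a *+ n).
Proof.
case=> k [k0 ak]; exists k; split=> //.
by rewrite -sb_mulrnA mulnC sb_mulrnA ak sb_mul0rn.
Qed.

Lemma torsion_of_mulrn a n : (0 < n)%N -> torsion (a *+ n) -> torsion a.
Proof.
move=> n0 [k [k0 ank]]; exists (n * k)%N.
by rewrite muln_gt0 n0 k0 sb_mulrnA.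
Qed.

Lemma torsion_addC a b : torsion (a + b) -> torsion (b + a).
Proof.
case=> n [n0 abn]; exists n; split=> //.
have conj m : (b + a) *+ m = - a + (a + b) *+ m + a.
  elim: m => [|m IHm]; first by rewrite sb_addr0 sb_addNr.
  by rewrite !sb_mulrS IHm !sb_addA sb_addNr sb_add0r sb_addrK.
by rewrite conj abn sb_addr0 sb_addNr.
Qed.

(** The order of [a + b] modulo [A] divides that of [a]. *)
Lemma torsion_add_normal A a b : add_normal A -> (forall c, A c -> torsion c) ->
  torsion a -> A b -> torsion (a + b).
Proof.
move=> [[A0 AD AN] Anorm] Ator [n [n0 an]] Ab.
have [c Ac abn] : exists2 c, A c & (a + b) *+ n = c + a *+ n.
  elim: n {n0 an} => [|n [c Ac IHn]]; first by exists 0; rewrite // sb_add0r.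
  exists (a + (b + c) - a); first exact/Anorm/AD.
  by rewrite !sb_mulrS IHn !sb_addA sb_subrK.
by apply: (torsion_of_mulrn n0); rewrite abn an sb_addr0; exact: Ator.
Qed.

(** * Additive subgroups generated by a set *)

Definition add_generated X : set B := smallest (@add_subgroup B) X.

Lemma add_generated_subgroup X : add_subgroup (add_generated X).
Proof.
split=> [A [[]] //|a b Xa Xb A AX|a Xa A AX].
- by case: (AX) => [[_ AD _] _]; apply: AD; [exact: Xa | exact: Xb].
- by case: (AX) => [[_ _ AN] _]; apply: AN; exact: Xa.
Qed.

Lemma sub_add_generated X : X `<=` add_generated X.
Proof. exact: sub_gen_smallest. Qed.

Lemma add_generated_sub X A : add_subgroup A -> X `<=` A -> add_generated X `<=` A.
Proof. exact: smallest_sub. Qed.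

Definition cyclic x : set B := add_generated [set x].

Lemma cyclic_id x : cyclic x x.
Proof. exact: sub_add_generated. Qed.
Arguments cyclic_id : clear implicits.

Lemma cyclic_sub x A : add_subgroup A -> A x -> cyclic x `<=` A.
Proof. by move=> Agrp Ax; apply: add_generated_sub => // _ ->. Qed.

Lemma cyclicP x a : cyclic x a -> exists n, a = x *+ n \/ - a = x *+ n.
Proof.
pose A := [set b | exists n, b = x *+ n \/ - b = x *+ n].
have AN b : A b -> A (- b).
  by case=> n [] bE; exists n; rewrite sb_opprK; [right | left].
have AsubR m n : A (x *+ m - x *+ n).
  have [/subnK mE|/ltnW/subnK nE] := leqP n m.
    by exists (m - n)%N; left; rewrite -{1}mE sb_mulrnDr sb_addrK.
  by exists (n - m)%N; right; rewrite sb_opprD sb_opprK -{1}nE sb_mulrnDr sb_addrK.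
have AsubL m n : A (- (x *+ m) + x *+ n).
  have [/subnKC nE|/ltnW/subnKC mE] := leqP m n.
    by exists (n - m)%N; left; rewrite -{1}nE sb_mulrnDr sb_addKr.
  by exists (m - n)%N; right; rewrite sb_opprD sb_opprK -{1}mE sb_mulrnDr sb_addKr.
apply: (@cyclic_sub x A); last by exists 1%N; left.
split=> //; first by exists 0%N; left.
move=> b c [m [bE|bE]] [n [cE|cE]].
- by exists (m + n)%N; left; rewrite sb_mulrnDr bE cE.
- by rewrite bE -[c]sb_opprK cE.
- by rewrite cE -[b]sb_opprK bE.
- by exists (n + m)%N; right; rewrite sb_opprD sb_mulrnDr bE cE.
Qed.

Lemma cyclic_torsion x a : torsion x -> cyclic x a -> torsion a.
Proof.
move=> xtor /cyclicP[n [->|aE]]; first exact: torsion_mulrn.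
by rewrite -[a]sb_opprK aE; exact/torsionN/torsion_mulrn.
Qed.

Lemma torsion_of_cyclic x a : cyclic x a -> torsion a -> a = 0 \/ torsion x.
Proof.
move=> /cyclicP[[|n] aE] ator.
  by left; case: aE => // aE; rewrite -[a]sb_opprK aE sb_oppr0.
right; apply: (@torsion_of_mulrn x n.+1) => //.
by case: aE => <- //; exact: torsionN.
Qed.

Lemma cyclic_comm x a : cyclic x a -> a + x = x + a.
Proof.
apply: (@cyclic_sub x [set b | b + x = x + b]) => //.
split=> [|b c /= bx cx|b /= bx]; first by rewrite /= sb_add0r sb_addr0.
- by rewrite -sb_addA cx !sb_addA bx.
- by apply: (@sb_addrI b); rewrite sb_addNKr sb_addA bx sb_addrK.
Qed.

Lemma lambda_cyclic a x b : lam a x = x -> cyclic x b -> lam a b = b.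
Proof. by move=> fx; apply: (cyclic_sub (fixed_add_subgroup a)). Qed.

(** If [n y = a] up to sign, then [lam x] fixes [n y], so that
[n y = n (a + y) = n a + n y] and [n a = 0]. *)
Lemma lambda_eq_torsion x y a : lam x y = a + y -> cyclic y a -> lam x a = a ->
  torsion a.
Proof.
move=> xy ya xa; have [[|n] aE] := cyclicP ya.
  have -> : a = 0 by case: aE => // aE; rewrite -[a]sb_opprK aE sb_oppr0.
  exact: torsion0.
exists n.+1; split=> //.
have : lam x (y *+ n.+1) = y *+ n.+1.
  by case: aE => <- //; rewrite lambdaN xa.
rewrite lambdaMn xy (sb_mulrnDl _ (cyclic_comm ya)) => ayn.
by apply: (@sb_addIr (y *+ n.+1)); rewrite ayn sb_add0r.
Qed.

(** * Dedekind skew braces *)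

(** This is the half of [x * y \in A] that uses normality in the group [\circ];
when [y] rather than [x] is in [A], invariance under [lam x] suffices. *)
Lemma ideal_lambdaB A x y : ideal A -> A x -> A (lam x y - y).
Proof.
move=> [[[_ AD AN] Anorm] Alam [_ Acirc]] Ax.
(* modulo [A], [x o y] equals [y o x], which is [y] *)
have -> : lam x y - y =
    - x + (y + lam y (y^-1%g \circ x \circ y^-1^-1%g) - y).
  by rewrite -circE sb_invgK -sb_circA sb_circVKg /lam sb_addA.
by apply: AD; [exact: AN | exact/Anorm/Alam/Acirc].
Qed.

Lemma cyclic_sub_skew_brace x : lam x x = x -> sub_skew_brace (cyclic x).
Proof.
move=> fx; have Zgrp := add_generated_subgroup [set x].
have lamZ a b : cyclic x a -> cyclic x b -> lam a b = b.
  suff : cyclic x `<=`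
      [set c | cyclic x c /\ forall d, cyclic x d -> lam c d = d].
    by move=> sub /sub[_]; apply.
  apply: cyclic_sub; first exact: kernel_add_subgroup.
  by split=> [|d]; [exact: cyclic_id | exact: lambda_cyclic].
case: (Zgrp) => Z0 ZD ZN; split=> //; split=> [|a b Za Zb|a Za].
- by rewrite sb_one0.
- by rewrite circE lamZ //; exact: ZD.
- rewrite (@sb_invg_unique _ (- a)); first exact: ZN.
  by rewrite circE lamZ ?sb_addrN ?sb_one0 //; exact: ZN.
Qed.

Hypothesis hded : dedekind B.

Lemma cyclic_ideal x : lam x x = x -> ideal (cyclic x).
Proof. by move=> fx; exact/hded/cyclic_sub_skew_brace. Qed.

Lemma torsionD_cyclic a b x : lam x x = x -> torsion x ->
  torsion a -> cyclic x b -> torsion (a + b).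
Proof.
move=> fx xtor ator xb; have [Znorm _ _] := cyclic_ideal fx.
by apply: (torsion_add_normal Znorm _ ator xb) => c; exact: cyclic_torsion.
Qed.

(** [x * y] lies in [Zx] and in [Zy]; lying in both it has finite order, by
[lambda_eq_torsion], but a cyclic group with a nonzero element of finite order
is finite. *)
Lemma lambda_self_fixed_nontorsion x y : lam x x = x -> lam y y = y ->
  ~ (torsion x /\ torsion y) -> lam x y = y.
Proof.
move=> fx fy ntor.
have Zx : cyclic x (lam x y - y).
  exact: (ideal_lambdaB y (cyclic_ideal fx) (cyclic_id x)).
have Zy : cyclic y (lam x y - y).
  have [[[_ ZD ZN] _] Zlam _] := cyclic_ideal fy.
  by apply: ZD; [exact: Zlam (cyclic_id y) | exact: ZN (cyclic_id y)].
have ator : torsion (lam x y - y).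
  apply: (@lambda_eq_torsion x y) => //; first by rewrite sb_subrK.
  exact: lambda_cyclic Zx.
have [/sb_subr_eq0 //|xtor] := torsion_of_cyclic Zx ator.
by have [/sb_subr_eq0 //|ytor] := torsion_of_cyclic Zy ator; case: ntor.
Qed.

Lemma lambda_self_fixed x y z : lam z z = z -> ~ torsion z ->
  lam x x = x -> lam y y = y -> lam x y = y.
Proof.
move=> fz ntz fx fy.
have [[xtor ytor]|] := pselect (torsion x /\ torsion y); last first.
  exact: lambda_self_fixed_nontorsion.
have zx : lam z x = x by apply: lambda_self_fixed_nontorsion => // -[].
have xz : lam x z = z by apply: lambda_self_fixed_nontorsion => // -[].
have zy : lam z y = y by apply: lambda_self_fixed_nontorsion => // -[].
(* [z + x] is the element of infinite order that acts on [y] as [x] does *)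
have lamzx c : lam (z + x) c = lam z (lam x c).
  by rewrite -{1}zx -circE lambdaM.
have fu : lam (z + x) (z + x) = z + x.
  by rewrite lamzx (lambdaD x) xz fx lambdaD fz zx.
have ntu : ~ torsion (z + x).
  move=> utor; apply: ntz; rewrite -(sb_addrK x z).
  apply: (torsionD_cyclic fx) => //.
  by have [_ _ ZN] := add_generated_subgroup [set x]; exact: ZN (cyclic_id x).
have uy : lam (z + x) y = y by apply: lambda_self_fixed_nontorsion => // -[].
have [_ Zlam _] := cyclic_ideal fy.
by rewrite -(lambda_cyclic zy (Zlam x y (cyclic_id y))) -lamzx uy.
Qed.

(** The additive subgroup generated by self-fixed elements is closed under all
[lam a], because each [cyclic x] is; therefore it is a sub-skew brace. *)
Lemma add_generated_full X : [set: B] = generated X ->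
  (forall x, X x -> lam x x = x) -> forall b, add_generated X b.
Proof.
move=> hgen fX; have Dgrp := add_generated_subgroup X.
case: (Dgrp) => D0 DD DN.
have Dlam a : add_generated X `<=` [set b | add_generated X (lam a b)].
  apply: add_generated_sub.
    split=> [|b c /= Db Dc|b /= Db]; first by rewrite /= lambda0.
    - by rewrite lambdaD; exact: DD.
    - by rewrite lambdaN; exact: DN.
  move=> x Xx /=; have [_ Zlam _] := cyclic_ideal (fX x Xx).
  apply: (cyclic_sub Dgrp (sub_add_generated Xx)).
  exact: Zlam (cyclic_id x).
move=> b; have : generated X b by rewrite -hgen.
apply; split; last exact: sub_add_generated.
split=> //; split=> [|a c Da Dc|a Da]; first by rewrite sb_one0.
- by rewrite circE; apply: DD => //; exact: Dlam.
- have -> : a^-1%g = - lam a^-1%g a.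
    by apply: (@sb_addIr (lam a^-1%g a)); rewrite -circE sb_addNr sb_circVg sb_one0.
  exact: DN (Dlam _ _ Da).
Qed.

Lemma all_torsion X : (forall b, add_generated X b) ->
  (forall x, X x -> lam x x = x) -> (forall x, X x -> torsion x) ->
  forall b, torsion b.
Proof.
move=> Xfull fX torX b.
(* the elements that preserve finite order under addition form a subgroup *)
pose P := [set c | forall a, torsion a -> torsion (a + c)].
suff /(_ b (Xfull b) 0 torsion0) : add_generated X `<=` P by rewrite sb_add0r.
apply: add_generated_sub.
  split=> [a|c d Pc Pd a ator|c Pc a ator]; first by rewrite sb_addr0.
  - by rewrite sb_addA; exact/Pd/Pc.
  - rewrite -[a + _]sb_opprK sb_opprD sb_opprK; apply: torsionN.
    exact/torsion_addC/Pc/torsionN.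
move=> x Xx a ator.
by apply: (torsionD_cyclic (fX x Xx)) => //; [exact: torX | exact: cyclic_id].
Qed.

(** [lam x] is additive in its argument, and [lam] is multiplicative in [x]:
hence the passage to all of [B], first in [y] and then in [x], the latter through
[kernel_add_subgroup]. *)
Lemma trivial_of_generators X : (forall b, add_generated X b) ->
  (forall x y, X x -> X y -> lam x y = y) -> trivial_brace B.
Proof.
move=> Xfull fXX a b.
suff lam_id : lam a b = b by rewrite circE lam_id.
have setTgrp : add_subgroup [set: B] by [].
suff /(_ a (Xfull a))[_ ->//] : add_generated X `<=`
    [set c | [set: B] c /\ forall d, [set: B] d -> lam c d = d].
apply: add_generated_sub; first exact: kernel_add_subgroup.
move=> x Xx; split=> // d _.
apply: (add_generated_sub (fixed_add_subgroup x) _ (Xfull d)) => y Xy.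
exact: fXX.
Qed.

End SkewBraceTheory.

Theorem theorem4p17 (B : skewBraceType) (hded : dedekind B)
  (hnper : ~ add_periodic B) (X : set B) (hgen : [set: B] = generated X)
  (hX : forall x : B, X x -> sb_star x x = 0) :
  trivial_brace B.
Proof.
have fX x : X x -> sb_lambda x x = x by move=> /hX /sb_subr_eq0.
have Xfull := add_generated_full hded hgen fX.
have [z Xz ntz] : exists2 z, X z & ~ torsion z.
  apply: contrapT => noz; apply: hnper => b; change (torsion b).
  apply: (all_torsion hded Xfull) => // x Xx.
  by apply: contrapT => ntx; apply: noz; exists x.
apply: (trivial_of_generators Xfull) => x y Xx Xy.
by apply: (lambda_self_fixed hded (fX z Xz) ntz); exact: fX.
Qed.
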